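(* There exist four-dimensional homogeneous pseudo-Riemannian manifolds $(M=G/H,g)$ with non-trivial isotropy, with $g$ a non-trivial (i.e. non-Einstein) homogeneous Ricci soliton, such that $(M,g)$ is locally conformally flat but not locally symmetric.
   Context: A pseudo-Riemannian metric $g$ on $M$ is a Ricci soliton if there are a smooth vector field $X$ and $\lambda\in\mathbb R$ with $\mathcal L_Xg+\varrho=\lambda g$, where $\varrho$ is the Ricci tensor of $g$. If $M=G/H$ is a homogeneous space, a homogeneous Ricci soliton on $M$ is a $G$-invariant metric $g$ for which this equation holds. Non-trivial isotropy means that $H$ has positive dimension (and $G$ acts almost effectively on $M$). In dimension four, $(M,g)$ is locally conformally flat if and only if its Weyl curvature tensor vanishes; it is locally symmetric if $\nabla R=0$, where $R$ is the curvature tensor and $\nabla$ the Levi-Civita connection. *)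

(* Defs.v *)
From mathcomp Require Import all_boot all_order all_algebra.
From mathcomp Require Import all_classical all_reals all_analysis.

Set Implicit Arguments.
Unset Strict Implicit.
Unset Printing Implicit Defensive.

Import Order.TTheory GRing.Theory Num.Theory.
Import numFieldNormedType.Exports.

Local Open Scope classical_set_scope.
Local Open Scope ring_scope.

(* Points of R^n are row vectors. *)

Definition partial (R : realType) (n : nat) (i : 'I_n) (f : 'rV[R]_n -> R)
  (x : 'rV[R]_n) : R := derive f x (delta_mx 0 i).

Fixpoint is_Cr (R : realType) (n r : nat) (U : set 'rV[R]_n)
    (f : 'rV[R]_n -> R) : Prop :=
  (forall x, U x -> {for x, continuous f}) /\
  match r with
  | 0 => True
  | r'.+1 => forall i : 'I_n,
      (forall x, U x -> derivable f x (delta_mx 0 i)) /\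
      is_Cr r' U (partial i f)
  end.

(* This is the usual C^oo smoothness for an open set U; it is only used for
   such sets. *)
Definition smooth_on (R : realType) (n : nat) (U : set 'rV[R]_n)
  (f : 'rV[R]_n -> R) : Prop := forall r, is_Cr r U f.

Definition smooth_map_on (R : realType) (m n : nat) (U : set 'rV[R]_m)
  (f : 'rV[R]_m -> 'rV[R]_n) : Prop :=
  forall j, smooth_on U (fun x => f x 0 j).

(* Row i holds the i-th partial derivatives, so tangent vectors are row vectors
   pushed forward by v |-> v *m J. *)
Definition jacobian_mx (R : realType) (m n : nat)
  (f : 'rV[R]_m -> 'rV[R]_n) (x : 'rV[R]_m) : 'M[R]_(m, n) :=
  \matrix_(i, j) partial i (fun y => f y 0 j) x.

(* The values of [cmap] outside [cdom] and of [cinv] outside [cmap @` cdom] are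
   irrelevant. *)
Record chart (R : realType) (T : topologicalType) (n : nat) := Chart {
  cdom : set T;
  cmap : T -> 'rV[R]_n;
  cinv : 'rV[R]_n -> T;
  cdom_open : open cdom;
  cimg_open : open (cmap @` cdom);
  cmapK : forall p, cdom p -> cinv (cmap p) = p;
  cmap_continuous : forall p, cdom p -> {for p, continuous cmap};
  cinv_continuous : forall x, (cmap @` cdom) x -> {for x, continuous cinv} }.

Definition cimg (R : realType) (T : topologicalType) (n : nat)
  (c : chart R T n) : set 'rV[R]_n := cmap c @` cdom c.

Definition transition (R : realType) (T : topologicalType) (n : nat)
  (c d : chart R T n) : 'rV[R]_n -> 'rV[R]_n := cmap d \o cinv c.

Definition compatible (R : realType) (T : topologicalType) (n : nat)
  (c d : chart R T n) : Prop :=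
  smooth_map_on (cmap c @` (cdom c `&` cdom d)) (transition c d) /\
  smooth_map_on (cmap d @` (cdom c `&` cdom d)) (transition d c).

Record manifold (R : realType) (n : nat) := Manifold {
  points :> topologicalType;
  manifold_hausdorff : hausdorff_space points;
  manifold_second_countable : @second_countable points;
  atlas : set (chart R points n);
  atlas_cover : forall p, exists2 c, atlas c & cdom c p;
  atlas_compatible : forall c d, atlas c -> atlas d -> compatible c d }.

Definition maximal_atlas (R : realType) (n : nat) (M : manifold R n) :
    set (chart R M n) :=
  [set c | forall d, atlas d -> compatible c d].

Definition smooth_fun_on (R : realType) (n : nat) (M : manifold R n)
    (U : set M) (f : M -> R) : Prop :=
  forall c : chart R M n, atlas c ->
    smooth_on (cmap c @` (cdom c `&` U)) (f \o cinv c).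

Definition smooth_map (R : realType) (m n : nat) (M : manifold R m)
    (N : manifold R n) (f : M -> N) : Prop :=
  continuous f /\
  forall (c : chart R M m) (d : chart R N n), atlas c -> atlas d ->
    smooth_map_on (cmap c @` (cdom c `&` f @^-1` cdom d))
                  (cmap d \o f \o cinv c).

(* Smoothness of a map M1 x M2 -> N; the charts of the product manifold are
   (p, q) |-> row_mx (cmap c1 p) (cmap c2 q). *)
Definition smooth_map2 (R : realType) (m1 m2 n : nat) (M1 : manifold R m1)
    (M2 : manifold R m2) (N : manifold R n) (f : M1 -> M2 -> N) : Prop :=
  continuous (fun z : M1 * M2 => f z.1 z.2) /\
  forall (c1 : chart R M1 m1) (c2 : chart R M2 m2) (d : chart R N n),
    atlas c1 -> atlas c2 -> atlas d ->
    smooth_map_on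
      ((fun z : M1 * M2 => row_mx (cmap c1 z.1) (cmap c2 z.2)) @`
         [set z | [/\ cdom c1 z.1, cdom c2 z.2 & cdom d (f z.1 z.2)]])
      (fun x => cmap d (f (cinv c1 (lsubmx x)) (cinv c2 (rsubmx x)))).

(* Around each of its points S is, in a suitable chart, the slice where all but
   the first d coordinates vanish. *)
Definition embedded_submanifold (R : realType) (n : nat) (M : manifold R n)
    (d : nat) (S : set M) : Prop :=
  (d <= n)%N /\
  forall p, S p -> exists c : chart R M n,
    [/\ maximal_atlas c, cdom c p &
        cmap c @` (cdom c `&` S) =
        cimg c `&` [set x | forall i : 'I_n, (d <= i)%N -> x 0 i = 0]].

Record lie_group (R : realType) (n : nat) := LieGroup {
  lie_manifold :> manifold R n;
  lmul : lie_manifold -> lie_manifold -> lie_manifold;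
  lone : lie_manifold;
  linv : lie_manifold -> lie_manifold;
  lmulA : forall a b c, lmul a (lmul b c) = lmul (lmul a b) c;
  lmul1g : forall a, lmul lone a = a;
  lmulVg : forall a, lmul (linv a) a = lone;
  lmul_smooth : smooth_map2 lmul;
  linv_smooth : smooth_map linv }.

Record lie_action (R : realType) (m n : nat) (G : lie_group R m)
    (M : manifold R n) := LieAction {
  act :> G -> M -> M;
  act1 : forall p, act (lone G) p = p;
  actM : forall a b p, act (lmul a b) p = act a (act b p);
  act_smooth : smooth_map2 act }.

Definition transitive_action (R : realType) (m n : nat) (G : lie_group R m)
    (M : manifold R n) (A : lie_action G M) : Prop :=
  forall p q : M, exists a, A a p = q.

(* The kernel of the action is a discrete subgroup. *)
Definition almost_effective (R : realType) (m n : nat) (G : lie_group R m)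
    (M : manifold R n) (A : lie_action G M) : Prop :=
  exists2 U : set G, nbhs (lone G) U &
    forall a, U a -> (forall p, A a p = p) -> a = lone G.

Definition isotropy (R : realType) (m n : nat) (G : lie_group R m)
    (M : manifold R n) (A : lie_action G M) (o : M) : set G :=
  [set a | A a o = o].

Definition positive_dimensional (R : realType) (n : nat) (M : manifold R n)
    (S : set M) : Prop :=
  exists2 d, (0 < d)%N & embedded_submanifold d S.

(* A metric is given by its matrices of components in the charts of the
   atlas. *)
Record metric (R : realType) (n : nat) (M : manifold R n) := Metric {
  gcomp : chart R M n -> 'rV[R]_n -> 'M[R]_n;
  gcomp_smooth : forall c, atlas c -> forall i j,
    smooth_on (cimg c) (fun x => gcomp c x i j);
  gcomp_sym : forall c, atlas c -> forall x, cimg c x ->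
    (gcomp c x)^T = gcomp c x;
  gcomp_nondegenerate : forall c, atlas c -> forall x, cimg c x ->
    gcomp c x \in unitmx;
  gcomp_transition : forall c d, atlas c -> atlas d ->
    forall p, cdom c p -> cdom d p ->
    let J := jacobian_mx (transition c d) (cmap c p) in
    gcomp c (cmap c p) = J *m gcomp d (cmap d p) *m J^T }.

Record vector_field (R : realType) (n : nat) (M : manifold R n) :=
    VectorField {
  vcomp : chart R M n -> 'rV[R]_n -> 'rV[R]_n;
  vcomp_smooth : forall c, atlas c -> smooth_map_on (cimg c) (vcomp c);
  vcomp_transition : forall c d, atlas c -> atlas d ->
    forall p, cdom c p -> cdom d p ->
    vcomp d (cmap d p) =
    vcomp c (cmap c p) *m jacobian_mx (transition c d) (cmap c p) }.

Definition invariant_metric (R : realType) (m n : nat) (G : lie_group R m)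
    (M : manifold R n) (A : lie_action G M) (g : metric M) : Prop :=
  forall (a : G) (c d : chart R M n), atlas c -> atlas d ->
    forall p, cdom c p -> cdom d (A a p) ->
    let J := jacobian_mx (cmap d \o A a \o cinv c) (cmap c p) in
    gcomp g c (cmap c p) = J *m gcomp g d (cmap d (A a p)) *m J^T.

(* Tensors attached to a metric with component matrix h in one coordinate
   system. *)

(* The Levi-Civita connection: nabla_(d_i) d_j = \sum_k (christoffel h k i j) d_k *)
Definition christoffel (R : realType) (n : nat) (h : 'rV[R]_n -> 'M[R]_n)
    (k i j : 'I_n) (x : 'rV[R]_n) : R :=
  2^-1 * \sum_(l < n) invmx (h x) k l *
    (partial i (fun y => h y j l) x + partial j (fun y => h y i l) x
     - partial l (fun y => h y i j) x).

(* The d_l-component of R(d_i, d_j) d_k, where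
   R(X, Y) = [nabla_X, nabla_Y] - nabla_[X, Y] *)
Definition curvature (R : realType) (n : nat) (h : 'rV[R]_n -> 'M[R]_n)
    (l k i j : 'I_n) (x : 'rV[R]_n) : R :=
  partial i (christoffel h l j k) x - partial j (christoffel h l i k) x
  + \sum_(m < n) (christoffel h l i m x * christoffel h m j k x
                  - christoffel h l j m x * christoffel h m i k x).

(* The d_l-component of (nabla_(d_m) R)(d_i, d_j) d_k *)
Definition nabla_curvature (R : realType) (n : nat)
    (h : 'rV[R]_n -> 'M[R]_n) (m l k i j : 'I_n) (x : 'rV[R]_n) : R :=
  partial m (curvature h l k i j) x
  + \sum_(s < n) (christoffel h l m s x * curvature h s k i j x
                  - christoffel h s m k x * curvature h l s i j x
                  - christoffel h s m i x * curvature h l k s j x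
                  - christoffel h s m j x * curvature h l k i s x).

(* The trace of Z |-> R(Z, d_i) d_j *)
Definition ricci (R : realType) (n : nat) (h : 'rV[R]_n -> 'M[R]_n)
    (x : 'rV[R]_n) : 'M[R]_n :=
  \matrix_(i, j) \sum_(l < n) curvature h l j l i x.

Definition lie_derivative (R : realType) (n : nat) (X : 'rV[R]_n -> 'rV[R]_n)
    (h : 'rV[R]_n -> 'M[R]_n) (x : 'rV[R]_n) : 'M[R]_n :=
  \matrix_(i, j) \sum_(k < n)
    (X x 0 k * partial k (fun y => h y i j) x
     + h x k j * partial i (fun y => X y 0 k) x
     + h x i k * partial j (fun y => X y 0 k) x).

Definition einstein (R : realType) (n : nat) (M : manifold R n)
    (g : metric M) : Prop :=
  exists lambda : R, forall c, atlas c -> forall x, cimg c x ->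
    ricci (gcomp g c) x = lambda *: gcomp g c x.

Definition ricci_soliton (R : realType) (n : nat) (M : manifold R n)
    (g : metric M) : Prop :=
  exists (X : vector_field M) (lambda : R),
    forall c, atlas c -> forall x, cimg c x ->
    lie_derivative (vcomp X c) (gcomp g c) x + ricci (gcomp g c) x =
    lambda *: gcomp g c x.

Definition locally_symmetric (R : realType) (n : nat) (M : manifold R n)
    (g : metric M) : Prop :=
  forall c, atlas c -> forall x, cimg c x ->
  forall m l k i j, nabla_curvature (gcomp g c) m l k i j x = 0.

(* Near every point some conformal metric exp(2f) g is flat. *)
Definition locally_conformally_flat (R : realType) (n : nat)
    (M : manifold R n) (g : metric M) : Prop :=
  forall p : M, exists (U : set M) (f : M -> R),
    [/\ open U, U p, smooth_fun_on U f &
        forall c : chart R M n, atlas c ->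
        forall x, (cmap c @` (cdom c `&` U)) x -> forall l k i j,
        curvature (fun y => expR (2 * f (cinv c y)) *: gcomp g c y) l k i j x
        = 0].

(* Main.v *)
Require Import Defs.
From mathcomp Require Import all_boot all_order all_algebra.
From mathcomp Require Import all_classical all_reals all_analysis.
From mathcomp Require Import ring lra.

Set Implicit Arguments.
Unset Strict Implicit.
Unset Printing Implicit Defensive.

Import Order.TTheory GRing.Theory Num.Theory.
Import numFieldNormedType.Exports.

Local Open Scope classical_set_scope.
Local Open Scope ring_scope.

(** The example is a homogeneous plane wave.  On R^4 with coordinates
    (s, v, x, y) let

      g = 2 ds dv + dx^2 + dy^2 - (6 v + 2 (x^2 + y^2)) ds^2.

    Putting w = exp s, X = exp(-s) x, Y = exp(-s) y and
    V = exp(-3 s) (v + (x^2 + y^2) / 2) gives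
    g = w^2 (2 dw dV + dX^2 + dY^2), so exp(-2 s) g is flat.  The scaling
    (w, V, X, Y) |-> (k w, k^-3 V, k^-1 X, k^-1 Y), the translations of V, X
    and Y, and the null rotation X |-> X + a w, V |-> V - a X - a^2 w / 2 are
    isometries; they generate a transitive five-dimensional group whose
    isotropy is one-dimensional.  The Ricci tensor is 4 ds^2, and the Lie
    derivative of g along d/dv is -6 ds^2, so (2/3) d/dv makes g a steady Ricci
    soliton, while g is not Einstein since g(d/ds, d/dv) = 1.  Finally, the
    component (nabla_s R)(d/dx, d/ds) d/ds along d/dx is -12 at the origin.

    All functions involved are built from coordinates and constants by sums,
    products and exponentials.  Such functions are reflected into a syntax
    with a symbolic derivative, which gives their smoothness at once and turns
    every tensor identity into an identity of real expressions. *)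

(** * Exponential polynomials *)

(* [Var k] stands for the k-th coordinate of a row vector of any length; it
   evaluates to 0 when k is out of range. *)
Inductive term (R : Type) :=
| T0 | T1
| Cst of R
| Var of nat
| Add of term R & term R
| Mul of term R & term R
| Exp of term R.
Arguments T0 {R}.
Arguments T1 {R}.
Arguments Var {R}.

(** Cancelling [T0] and [T1] at once keeps iterated symbolic derivatives small: most tensor
    components collapse to [T0] by computation. *)
Definition tadd R (a b : term R) : term R :=
  match a, b with T0, _ => b | _, T0 => a | _, _ => Add a b end.

Definition tmul R (a b : term R) : term R :=
  match a, b with
  | T0, _ | _, T0 => T0
  | T1, _ => b
  | _, T1 => a
  | _, _ => Mul a b
  end.

Fixpoint tder R (k : nat) (e : term R) : term R :=
  match e with
  | T0 | T1 | Cst _ => T0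
  | Var j => if j == k then T1 else T0
  | Add a b => tadd (tder k a) (tder k b)
  | Mul a b => tadd (tmul (tder k a) b) (tmul a (tder k b))
  | Exp a => tmul (tder k a) (Exp a)
  end.

Section TermSemantics.
Variables (R : realType) (n : nat).
Implicit Types (x v : 'rV[R]_n) (e : term R).

Definition coordinate x (k : nat) : R :=
  if insub k : option 'I_n is Some i then x 0 i else 0.

Lemma coordinateE x (i : 'I_n) : coordinate x i = x 0 i.
Proof. by rewrite /coordinate valK. Qed.

Fixpoint ev e x : R :=
  match e with
  | T0 => 0
  | T1 => 1
  | Cst r => r
  | Var k => coordinate x k
  | Add a b => ev a x + ev b x
  | Mul a b => ev a x * ev b x
  | Exp a => expR (ev a x)
  end.

Lemma ev_tadd a b x : ev (tadd a b) x = ev a x + ev b x.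
Proof. by case: a; case: b => *; rewrite /= ?addr0 ?add0r. Qed.

Lemma ev_tmul a b x : ev (tmul a b) x = ev a x * ev b x.
Proof. by case: a; case: b => *; rewrite /= ?mulr0 ?mul0r ?mulr1 ?mul1r. Qed.

Lemma ev_continuous e : continuous (ev e).
Proof.
elim: e => [||r|k|a IHa b IHb|a IHa b IHb|a IHa] x; try exact: cst_continuous.
- rewrite /= /coordinate; case: insubP => [i _ _|_]; last exact: cst_continuous.
  by move=> ?; apply: (@coord_continuous R 1 n 0 i x).
- exact: (cvgD (IHa x) (IHb x)).
- exact: (cvgM (IHa x) (IHb x)).
- apply: (@continuous_comp _ _ _ (ev a) (@expR R)); first exact: IHa.
  exact: continuous_expR.
Qed.

(** Both sides have the same difference quotient, so a directional derivative reduces to the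
    one-variable rules for products and compositions. *)
Lemma is_derive_line (f : 'rV[R]_n -> R) x v d :
  is_derive (0 : R) 1 (fun h : R => f (h *: v + x)) d -> is_derive x v f d.
Proof.
have E : (fun h : R => h^-1 *: (f ((h *: 1 + 0) *: v + x) - f (0 *: v + x))) =
  (fun h : R => h^-1 *: (f (h *: v + x) - f x)).
  by apply/funext => h; rewrite scale0r add0r addr0 [h *: 1]mulr1.
case=> D1 D2; split.
  by move: D1; rewrite /derivable /comp /shift/= E.
by move: D2; rewrite /derive /comp /shift/= E.
Qed.

Lemma ev_is_derive_line e x (i : 'I_n) :
  is_derive (0 : R) 1 (fun h : R => ev e (h *: delta_mx 0 i + x)) (ev (tder i e) x).
Proof.
elim: e => [||r|k|a IHa b IHb|a IHa b IHb|a IHa] /=.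
- exact: is_derive_cst.
- exact: is_derive_cst.
- exact: is_derive_cst.
- rewrite /coordinate; case: insubP => [j _ jk|]; last first.
    (* An out-of-range variable evaluates to the constant 0; its symbolic derivative is [T1] only if
       [k = i], which [i < n] excludes. *)
    rewrite -leqNgt => nk; case: eqP => [E|_] /=; last exact: is_derive_cst.
    by move: nk; rewrite E leqNgt ltn_ord.
  rewrite -jk.
  have -> : (fun h : R => (h *: delta_mx 0 i + x) 0 j) =
     (fun h : R => h * (j == i)%:R + x 0 j) by apply/funext => h; rewrite !mxE.
  rewrite (_ : ev _ x = (j == i)%:R); last first.
    by rewrite (_ : (val j == i) = (j == i)) //; case: eqP.
  apply: is_derive_eq; by rewrite addr0 scaler0 add0r [_ *: _]mulr1.
- by rewrite ev_tadd; apply: is_deriveD.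
- rewrite ev_tadd !ev_tmul.
  apply: is_derive_eq; rewrite scale0r add0r addrC mulrC; congr (_ + _).
- rewrite ev_tmul /=.
  have := @is_derive1_comp _ expR (fun h : R => ev a (h *: delta_mx 0 i + x)) 0
    (expR (ev a x)) (ev (tder i a) x).
  rewrite /= scale0r add0r => H.
  rewrite mulrC; apply: H.
Qed.

Lemma ev_is_derive e x (i : 'I_n) :
  is_derive x (delta_mx 0 i) (ev e) (ev (tder i e) x).
Proof. exact/is_derive_line/ev_is_derive_line. Qed.

Lemma partial_ev e i : partial i (ev e) = ev (tder i e).
Proof.
by apply/funext => x; rewrite /partial (@derive_val _ _ _ _ _ _ _ (ev_is_derive e x i)).
Qed.

(** Terms are closed under partial derivatives, so induction on the order suffices, with the term
    generalised. *)
Lemma ev_smooth U e : smooth_on U (ev e).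
Proof.
move=> r; elim: r e => [|r IH] e /=; split=> //.
- by move=> x _; exact: ev_continuous.
- by move=> x _; exact: ev_continuous.
move=> i; split; last by rewrite partial_ev.
by move=> x _; have [] := ev_is_derive e x i.
Qed.

End TermSemantics.

(** * Topology of the space of row vectors *)

Section RowVectorSpace.
Variables (R : realType) (n : nat).

Lemma entrywise_continuous_at (T : topologicalType) (m : nat)
    (f : T -> 'M[R]_(m, n)) t :
  (forall i j, {for t, continuous (fun u => f u i j)}) -> {for t, continuous f}.
Proof.
move=> fc A [P fP sPA].
have : \forall u \near t, forall i j, P i j (f u i j).
  by apply: filter_forall => i; apply: filter_forall => j; apply: (fc i j); exact: fP.
by apply: filterS => u Pu; apply: sPA => i j; exact: Pu.
Qed.

Lemma rV_hausdorff : hausdorff_space 'rV[R]_n.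
Proof. exact: norm_hausdorff. Qed.

Definition rat_box (ab : 'rV[rat]_n * 'rV[rat]_n) : set 'rV[R]_n :=
  [set x | forall j, ratr (ab.1 0 j) < x 0 j < ratr (ab.2 0 j)].

Lemma rV_second_countable : @second_countable 'rV[R]_n.
Proof.
exists (range rat_box).
  apply: sub_countable (card_image_le _ _) _; exact: countableP.
split.
- move=> _ [[a b] _ <-]; rewrite openE => x /= abx.
  exists (fun _ j => [set` `](ratr (a 0 j) : R), (ratr (b 0 j))[]).
    by move=> i j; rewrite ord1; apply: near_in_itvoo; rewrite in_itv; exact: abx.
  by move=> y aby j; have := aby 0 j; rewrite /= in_itv.
- move=> x A [P xP sPA].
  (* Each coordinate gets a rational interval around it inside the given neighbourhood; their
     product is the required box. *)
  have /choice[ab abP] : forall j, exists ab : rat * rat,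
      ratr ab.1 < x 0 j < ratr ab.2 /\
      forall r, ratr ab.1 < r < ratr ab.2 -> P 0 j r.
    move=> j; have /nbhs_ballP[e /= e0 eP] := xP 0 j.
    have [a] := @rat_in_itvoo R (x 0 j - e) (x 0 j) ltac:(lra).
    have [b] := @rat_in_itvoo R (x 0 j) (x 0 j + e) ltac:(lra).
    rewrite !in_itv /= => /andP[b1 b2] /andP[a1 a2].
    exists (a, b); split=> /=; first lra.
    by move=> r /andP[r1 r2]; apply: eP; rewrite /ball /= ltr_norml; lra.
  exists (rat_box (\row_j (ab j).1, \row_j (ab j).2)) => /=.
    split; first by exists (\row_j (ab j).1, \row_j (ab j).2).
    by move=> j /=; rewrite !mxE; have [] := abP j.
  move=> y /= by_; apply: sPA => i j; rewrite ord1.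
  by have [_] := abP j; apply; have := by_ j; rewrite !mxE.
Qed.

End RowVectorSpace.

(** * Vectors, matrices and tensors with exponential polynomial entries *)

Fixpoint tsum R (n : nat) (F : nat -> term R) : term R :=
  if n is n'.+1 then tadd (tsum n' F) (F n') else T0.

(** Variables beyond [n] go to [T0] because [coordinate] vanishes there on rows of length [n]; hence
    evaluation commutes with substitution for every term. *)
Fixpoint tsubst R n (s : nat -> term R) (e : term R) : term R :=
  match e with
  | T0 => T0 | T1 => T1
  | Cst r => Cst r
  | Var k => if (k < n)%N then s k else T0
  | Add a b => Add (tsubst n s a) (tsubst n s b)
  | Mul a b => Mul (tsubst n s a) (tsubst n s b)
  | Exp a => Exp (tsubst n s a)
  end.

Definition tsub (R : realType) (a b : term R) := tadd a (tmul (Cst (-1)) b).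

Lemma ev_tsub (R : realType) n (a b : term R) (x : 'rV[R]_n) :
  ev (tsub a b) x = ev a x - ev b x.
Proof. by rewrite /tsub ev_tadd ev_tmul /= mulN1r. Qed.

Lemma ev_tsum (R : realType) n m F (x : 'rV[R]_n) :
  ev (tsum m F) x = \sum_(l < m) ev (F l) x.
Proof.
by elim: m => [|m IH]; rewrite /= ?big_ord0 // big_ord_recr ev_tadd IH.
Qed.

Section TermMaps.
Variable R : realType.

Definition evrow m n (s : nat -> term R) (x : 'rV[R]_m) : 'rV[R]_n :=
  \row_j ev (s j) x.

Definition evmx m n (A : nat -> nat -> term R) (x : 'rV[R]_m) : 'M[R]_n :=
  \matrix_(i, j) ev (A i j) x.

Lemma coordinate_evrow m n (s : nat -> term R) (x : 'rV[R]_m) k :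
  coordinate (evrow n s x) k = if (k < n)%N then ev (s k) x else 0.
Proof.
by rewrite /coordinate; case: insubP => [i -> <-|/negbTE ->] //; rewrite mxE.
Qed.

Lemma coordinate_row_mx m n (x : 'rV[R]_m) (y : 'rV[R]_n) k :
  coordinate (row_mx x y) k =
  if (k < m)%N then coordinate x k else coordinate y (k - m).
Proof.
case: ifP => km.
  rewrite -[k]/(nat_of_ord (lshift n (Ordinal km))) coordinateE.
  by rewrite row_mxEl -coordinateE.
rewrite {2}/coordinate; case: insubP => [i _ ik|kn].
  have -> : k = rshift m i :> nat by rewrite /= ik subnKC // leqNgt km.
  by rewrite coordinateE row_mxEr.
rewrite /coordinate insubF //; apply: contraNF kn => kmn.
by rewrite ltn_subLR // leqNgt km.
Qed.

Lemma coordinate0 n k : coordinate (0 : 'rV[R]_n) k = 0.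
Proof. by rewrite /coordinate; case: insub => // i; rewrite mxE. Qed.

Lemma coordinateP n (x y : 'rV[R]_n) :
  (forall k, (k < n)%N -> coordinate x k = coordinate y k) -> x = y.
Proof. by move=> xy; apply/rowP => i; rewrite -!coordinateE xy. Qed.

Lemma ev_tsubst m n (s : nat -> term R) e (x : 'rV[R]_m) :
  ev (tsubst n s e) x = ev e (evrow n s x).
Proof.
elim: e => //= [k|a -> b ->|a -> b ->|a ->] //.
by rewrite coordinate_evrow; case: ifP.
Qed.

Lemma evrow_continuous m n s : continuous (@evrow m n s).
Proof.
move=> x; apply: entrywise_continuous_at => i j.
rewrite (_ : (fun _ => _) = ev (s j)); first exact: ev_continuous.
by apply/funext => y; rewrite mxE.
Qed.

Lemma evrow_smooth m n U s : smooth_map_on U (@evrow m n s).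
Proof.
move=> j; rewrite (_ : (fun _ => _) = ev (s j)); first exact: ev_smooth.
by apply/funext => y; rewrite mxE.
Qed.

Lemma jacobian_evrow n s (x : 'rV[R]_n) :
  jacobian_mx (evrow n s) x = evmx n (fun i j => tder i (s j)) x.
Proof.
apply/matrixP => i j; rewrite !mxE -partial_ev; congr (partial i _ x).
by apply/funext => y; rewrite mxE.
Qed.

Lemma evmxM m n A B (x : 'rV[R]_m) :
  evmx n A x *m evmx n B x =
  evmx n (fun i j => tsum n (fun k => tmul (A i k) (B k j))) x.
Proof.
apply/matrixP => i j; rewrite !mxE ev_tsum; apply: eq_bigr => k _.
by rewrite !mxE ev_tmul.
Qed.

Lemma trmx_evmx m n A (x : 'rV[R]_m) : (evmx n A x)^T = evmx n (fun i j => A j i) x.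
Proof. by apply/matrixP => i j; rewrite !mxE. Qed.

Lemma eq_evmx m n A B (x : 'rV[R]_m) :
  (forall i j, (i < n)%N -> (j < n)%N -> ev (A i j) x = ev (B i j) x) ->
  evmx n A x = evmx n B x.
Proof. by move=> AB; apply/matrixP => i j; rewrite !mxE AB. Qed.

End TermMaps.

Section TermTensors.
Variables (R : realType) (n : nat).
Implicit Types (g gi : nat -> nat -> term R) (Gam : nat -> nat -> nat -> term R).

Definition tchris g gi k i j : term R :=
  tmul (Cst 2^-1) (tsum n (fun l => tmul (gi k l)
    (tsub (tadd (tder i (g j l)) (tder j (g i l))) (tder l (g i j))))).

Definition tcurv Gam l k i j : term R :=
  tadd (tsub (tder i (Gam l j k)) (tder j (Gam l i k)))
    (tsum n (fun m => tsub (tmul (Gam l i m) (Gam m j k))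
      (tmul (Gam l j m) (Gam m i k)))).

Definition tnabla Gam (C : nat -> nat -> nat -> nat -> term R) m l k i j : term R :=
  tadd (tder m (C l k i j))
    (tsum n (fun s => tsub (tsub (tsub (tmul (Gam l m s) (C s k i j))
       (tmul (Gam s m k) (C l s i j)))
       (tmul (Gam s m i) (C l k s j)))
       (tmul (Gam s m j) (C l k i s)))).

Definition tricci Gam i j : term R := tsum n (fun l => tcurv Gam l j l i).

Definition tlie (X : nat -> term R) g i j : term R :=
  tsum n (fun k => tadd (tadd (tmul (X k) (tder k (g i j)))
     (tmul (g k j) (tder i (X k)))) (tmul (g i k) (tder j (X k)))).

Lemma partial_evmx g i j k :
  partial k (fun y : 'rV[R]_n => evmx n g y i j) = ev (tder k (g i j)).
Proof.
by rewrite -partial_ev; congr partial; apply/funext => y; rewrite mxE.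
Qed.

Lemma christoffel_ev g gi (k i j : 'I_n) (x : 'rV[R]_n) :
  evmx n g x *m evmx n gi x = 1%:M ->
  christoffel (evmx n g) k i j x = ev (tchris g gi k i j) x.
Proof.
move=> gK; have gu := mulmx1_unit gK.
have -> : christoffel (evmx n g) k i j x = 2^-1 * \sum_(l < n) (evmx n gi x) k l *
    (partial i (fun y => evmx n g y j l) x + partial j (fun y => evmx n g y i l) x
     - partial l (fun y => evmx n g y i j) x).
  (* By uniqueness of inverses, [invmx] may be traded for the explicit table [gi]. *)
  rewrite /christoffel -[evmx n gi x]mul1mx -(mulVmx gu.1) -mulmxA gK mulmx1 //.
rewrite ev_tmul ev_tsum; congr (_ * _); apply: eq_bigr => l _.
by rewrite ev_tmul ev_tsub ev_tadd !partial_evmx mxE.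
Qed.

(** [Gam] may be any table with the right values, so simplified Christoffel symbols can be put in
    before differentiating. *)
Lemma curvature_ev h Gam :
  (forall k i j : 'I_n, christoffel h k i j = ev (Gam k i j)) ->
  forall l k i j : 'I_n, curvature h l k i j = ev (tcurv Gam l k i j).
Proof.
move=> hG l k i j; apply/funext => x.
rewrite /curvature ev_tadd ev_tsub ev_tsum !hG !partial_ev; congr (_ + _).
by apply: eq_bigr => m _; rewrite ev_tsub !ev_tmul !hG.
Qed.

Lemma nabla_curvature_ev h Gam (C : nat -> nat -> nat -> nat -> term R) :
  (forall k i j : 'I_n, christoffel h k i j = ev (Gam k i j)) ->
  (forall l k i j : 'I_n, curvature h l k i j = ev (C l k i j)) ->
  forall m l k i j : 'I_n, nabla_curvature h m l k i j = ev (tnabla Gam C m l k i j).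
Proof.
move=> hG hC m l k i j; apply/funext => x.
rewrite /nabla_curvature ev_tadd ev_tsum !hC !partial_ev; congr (_ + _).
by apply: eq_bigr => s _; rewrite !ev_tsub !ev_tmul !hG !hC.
Qed.

Lemma ricci_ev h Gam :
  (forall k i j : 'I_n, christoffel h k i j = ev (Gam k i j)) ->
  ricci h = evmx n (tricci Gam).
Proof.
move=> hG; apply/funext => x; apply/matrixP => i j; rewrite !mxE ev_tsum.
by apply: eq_bigr => l _; rewrite (curvature_ev hG).
Qed.

Lemma lie_derivative_ev X g :
  lie_derivative (evrow n X) (evmx n g) = evmx n (tlie X g).
Proof.
apply/funext => x; apply/matrixP => i j; rewrite !mxE ev_tsum.
have pX k l : partial k (fun y : 'rV[R]_n => evrow n X y 0 l) = ev (tder k (X l)).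
  by rewrite -partial_ev; congr partial; apply/funext => y; rewrite mxE.
apply: eq_bigr => k _.
rewrite -!/(partial _ _) !ev_tadd !ev_tmul.
by rewrite !partial_evmx !pX !mxE.
Qed.

End TermTensors.

(** * R^n as a manifold with one global chart *)

Section AffineManifold.
Variable R : realType.

Lemma id_chart_img_open n : open (id @` [set: 'rV[R]_n]).
Proof. by rewrite image_id; exact: openT. Qed.

Definition id_chart n : chart R 'rV[R]_n n :=
  @Chart R 'rV[R]_n n setT id id openT (@id_chart_img_open n)
    (fun _ _ => erefl) (fun _ _ => @cvg_id _ _) (fun _ _ => @cvg_id _ _).

Lemma id_evrow n : (id : 'rV[R]_n -> 'rV[R]_n) = evrow n Var.
Proof. by apply/funext => x; apply/rowP => j; rewrite mxE /= coordinateE. Qed.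

Lemma id_chart_compatible n : compatible (id_chart n) (id_chart n).
Proof.
have sm U : smooth_map_on U (transition (id_chart n) (id_chart n)).
  by rewrite [transition _ _]id_evrow; exact: evrow_smooth.
by split; exact: sm.
Qed.

Lemma id_atlas_compatible n c d :
  [set id_chart n] c -> [set id_chart n] d -> compatible c d.
Proof. by move=> -> ->; exact: id_chart_compatible. Qed.

Definition affine_space n : manifold R n :=
  @Manifold R n 'rV[R]_n (@rV_hausdorff R n) (@rV_second_countable R n)
    [set id_chart n] (fun p => ex_intro2 _ _ (id_chart n) erefl I)
    (@id_atlas_compatible n).

Lemma jacobian_transition_id n x :
  jacobian_mx (transition (id_chart n) (id_chart n)) x = 1%:M.
Proof.
rewrite [transition _ _]id_evrow jacobian_evrow; apply/matrixP => i j.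
by rewrite !mxE /= eq_sym -(inj_eq val_inj) /=; case: eqP.
Qed.

Lemma evrow_smooth_map m n s :
  @smooth_map R m n (affine_space m) (affine_space n) (evrow n s).
Proof.
by split; [exact: evrow_continuous|move=> c d -> ->; exact: evrow_smooth].
Qed.

Lemma evrow_smooth_map2 m1 m2 n s :
  @smooth_map2 R m1 m2 n (affine_space m1) (affine_space m2) (affine_space n)
    (fun a b => evrow n s (row_mx a b)).
Proof.
split; last first.
  move=> c1 c2 d -> -> ->.
  rewrite (_ : (fun _ => _) = evrow n s); first exact: evrow_smooth.
  by apply/funext => x /=; rewrite hsubmxK.
move=> z; apply: (@continuous_comp _ _ _
  (fun z : 'rV[R]_m1 * 'rV[R]_m2 => row_mx z.1 z.2) (evrow n s));
  last exact: evrow_continuous.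
apply: entrywise_continuous_at => i j; rewrite ord1.
have [k jk|k jk] := splitP j.
  rewrite (_ : (fun _ => _) = (fun v : 'rV[R]_m1 => v 0 k) \o fst); last first.
    apply/funext => w /=; rewrite (_ : j = lshift m2 k) ?row_mxEl //.
    exact: val_inj.
  by apply: continuous_comp; [exact: cvg_fst|exact: coord_continuous].
rewrite (_ : (fun _ => _) = (fun v : 'rV[R]_m2 => v 0 k) \o snd); last first.
  apply/funext => w /=; rewrite (_ : j = rshift m1 k) ?row_mxEr //.
  exact: val_inj.
by apply: continuous_comp; [exact: cvg_snd|exact: coord_continuous].
Qed.

End AffineManifold.

(** * The plane wave *)

Section PlaneWave.
Variable R : realType.

Local Notation "a +' b" := (Add a b) (at level 50, left associativity).
Local Notation "a *' b" := (Mul a b) (at level 40, left associativity).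
Local Notation "-' a" := (Mul (Cst (-1 : R)) a) (at level 35, right associativity).

(* In the coordinates (s, v, x, y), where v depends on X and Y as well, a
   translation of X composed with a null rotation reads
   (v, x) |-> (v - p' x - p p' / 2, x + p) with
   p(s) = (c - a) e^s + a e^(2s) and p' its derivative; q(s) = d e^s does the
   same for y.  The parameter c is p(0), so that the isotropy group of the
   origin is the axis of the parameter a, which is the first coordinate of the
   group. *)
Definition act_term (a t b c d s v x y : term R) (j : nat) : term R :=
  let e := Exp s in
  let p := (c +' -' a) *' e +' a *' (e *' e) in
  let p' := (c +' -' a) *' e +' Cst 2 *' a *' (e *' e) in
  let q := d *' e in
  match j with
  | 0 => s +' t
  | 1 => v +' -' (p' *' x +' q *' y) +' -' (Cst 2^-1 *' (p *' p' +' q *' q))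
         +' b *' (e *' e *' e)
  | 2 => x +' p
  | _ => y +' q
  end.

(* The law is read off from the action.  The last summand of the third coordinate
   is, up to the factor e^(3s), half the Wronskian of the two functions p. *)
Definition mul_term (a2 t2 b2 c2 d2 a1 t1 b1 c1 d1 : term R) (j : nat) :
    term R :=
  let e := Exp t1 in
  match j with
  | 0 => a1 +' e *' e *' a2
  | 1 => t1 +' t2
  | 2 => b1 +' e *' e *' e *' b2 +'
    Cst 2^-1 *' (a1 *' e *' (c2 +' -' a2)
                 +' -' ((c1 +' -' a1) *' (e *' e) *' a2))
  | 3 => c1 +' e *' (c2 +' -' a2) +' e *' e *' a2
  | _ => d1 +' e *' d2
  end.

Definition inv_term (a t b c d : term R) (j : nat) : term R :=
  let e := Exp (-' t) in
  match j with
  | 0 => -' (e *' e *' a)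
  | 1 => -' t
  | 2 => -' (e *' e *' e *' b)
  | 3 => -' (e *' (c +' -' a) +' e *' e *' a)
  | _ => -' (e *' d)
  end.

Definition gmul (g h : 'rV[R]_5) : 'rV[R]_5 :=
  evrow 5 (mul_term (Var 0) (Var 1) (Var 2) (Var 3) (Var 4)
                    (Var 5) (Var 6) (Var 7) (Var 8) (Var 9)) (row_mx g h).

Definition ginv (g : 'rV[R]_5) : 'rV[R]_5 :=
  evrow 5 (inv_term (Var 0) (Var 1) (Var 2) (Var 3) (Var 4)) g.

Definition gact (g : 'rV[R]_5) (p : 'rV[R]_4) : 'rV[R]_4 :=
  evrow 4 (act_term (Var 0) (Var 1) (Var 2) (Var 3) (Var 4)
                    (Var 5) (Var 6) (Var 7) (Var 8)) (row_mx g p).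

Local Ltac coordinates :=
  rewrite ?(coordinate_evrow, coordinate_row_mx, coordinate0) /=.

Lemma gmulA a b c : gmul a (gmul b c) = gmul (gmul a b) c.
Proof.
apply: coordinateP => -[|[|[|[|[|//]]]]] _; rewrite /gmul; do ! coordinates;
  rewrite ?expRD; by field.
Qed.

Lemma gmul1g a : gmul 0 a = a.
Proof.
apply: coordinateP => -[|[|[|[|[|//]]]]] _; rewrite /gmul; do ! coordinates; by ring.
Qed.

Lemma gmulVg a : gmul (ginv a) a = 0.
Proof.
apply: coordinateP => -[|[|[|[|[|//]]]]] _; rewrite /gmul /ginv; do ! coordinates;
  rewrite ?mulN1r ?expRN; by field; rewrite ?gt_eqF ?expR_gt0.
Qed.

Lemma gact1 p : gact 0 p = p.
Proof.
apply: coordinateP => -[|[|[|[|//]]]] _; rewrite /gact; do ! coordinates; by ring.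
Qed.

Lemma gactM g h p : gact (gmul g h) p = gact g (gact h p).
Proof.
apply: coordinateP => -[|[|[|[|//]]]] _; rewrite /gact /gmul; do ! coordinates;
  rewrite ?expRD; by field.
Qed.

Definition model_group : lie_group R 5 :=
  @LieGroup R 5 (affine_space R 5) gmul 0 ginv gmulA gmul1g gmulVg
   (@evrow_smooth_map2 R 5 5 5 _) (@evrow_smooth_map R 5 5 _).

Definition model_action : lie_action model_group (affine_space R 4) :=
  @LieAction R 5 4 model_group (affine_space R 4) gact gact1 gactM
    (@evrow_smooth_map2 R 5 4 4 _).

(** * The metric, its Christoffel symbols and its curvature *)

Definition metric_term (i j : nat) : term R :=
  match i, j with
  | 0, 0 => -' (Cst 6 *' Var 1 +' Cst 2 *' (Var 2 *' Var 2 +' Var 3 *' Var 3))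
  | 0, 1 | 1, 0 | 2, 2 | 3, 3 => T1
  | _, _ => T0
  end.

Definition inverse_metric_term (i j : nat) : term R :=
  match i, j with
  | 1, 1 => Cst 6 *' Var 1 +' Cst 2 *' (Var 2 *' Var 2 +' Var 3 *' Var 3)
  | 0, 1 | 1, 0 | 2, 2 | 3, 3 => T1
  | _, _ => T0
  end.

Definition christoffel_term (k i j : nat) : term R :=
  match k, i, j with
  | 0, 0, 0 => Cst 3
  | 1, 0, 0 => Cst 18 *' Var 1 +' Cst 6 *' (Var 2 *' Var 2 +' Var 3 *' Var 3)
  | 1, 0, 1 | 1, 1, 0 => Cst (-3)
  | 1, 0, 2 | 1, 2, 0 => Cst (-2) *' Var 2
  | 1, 0, 3 | 1, 3, 0 => Cst (-2) *' Var 3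
  | 2, 0, 0 => Cst 2 *' Var 2
  | 3, 0, 0 => Cst 2 *' Var 3
  | _, _, _ => T0
  end.

(* Christoffel symbols of exp(-2 s) g. *)
Definition flat_christoffel_term (k i j : nat) : term R :=
  match k, i, j with
  | 0, 0, 0 => T1
  | 1, 0, 0 => Cst 12 *' Var 1 +' Cst 4 *' (Var 2 *' Var 2 +' Var 3 *' Var 3)
  | 1, 0, 1 | 1, 1, 0 => Cst (-3)
  | 1, 0, 2 | 1, 2, 0 => Cst (-2) *' Var 2
  | 1, 0, 3 | 1, 3, 0 => Cst (-2) *' Var 3
  | 1, 2, 2 | 1, 3, 3 => T1
  | 2, 0, 0 => Cst 2 *' Var 2
  | 3, 0, 0 => Cst 2 *' Var 3
  | 2, 0, 2 | 2, 2, 0 | 3, 0, 3 | 3, 3, 0 => Cst (-1)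
  | _, _, _ => T0
  end.

Lemma metric_termK (x : 'rV[R]_4) :
  evmx 4 metric_term x *m evmx 4 inverse_metric_term x = 1%:M.
Proof.
rewrite evmxM; apply/matrixP => i j; rewrite !mxE -!val_eqE.
by case: i j => -[|[|[|[|//]]]] ? [[|[|[|[|//]]]] ?]; rewrite /=; by ring.
Qed.

Lemma model_christoffel (k i j : 'I_4) :
  christoffel (evmx 4 metric_term) k i j = ev (christoffel_term k i j).
Proof.
apply/funext => x; rewrite (christoffel_ev _ _ _ (metric_termK x)).
by case: k i j => -[|[|[|[|//]]]] ? [[|[|[|[|//]]]] ?] [[|[|[|[|//]]]] ?];
  rewrite /tchris /tsub /=; by field.
Qed.

Lemma flat_christoffel (k i j : 'I_4) :
  christoffel (fun y : 'rV[R]_4 => expR (2 * - y 0 0) *: evmx 4 metric_term y)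
    k i j =
  ev (flat_christoffel_term k i j).
Proof.
have -> : (fun y : 'rV[R]_4 => expR (2 * - y 0 0) *: evmx 4 metric_term y) =
    evmx 4 (fun i j => tmul (Exp (Cst (-2) *' Var 0)) (metric_term i j)).
  apply/funext => y; apply/matrixP => a b; rewrite !mxE ev_tmul /=.
  by rewrite -(coordinateE y 0) /= mulrN mulNr.
apply/funext => x.
(* The inverse of exp(-2 s) g is exp(2 s) times the inverse of g. *)
rewrite (@christoffel_ev _ _ _ (fun i j =>
  tmul (Exp (Cst 2 *' Var 0)) (inverse_metric_term i j))); last first.
  rewrite -(metric_termK x).
  have E A f : evmx 4 (fun i j => tmul (Exp f) (A i j)) x =
      expR (ev f x) *: evmx 4 A x.
    by apply/matrixP => a b; rewrite !mxE ev_tmul.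
  rewrite !E -scalemxAl -scalemxAr scalerA -expRD /=.
  by rewrite mulNr addNr expR0 scale1r.
(* With a single nonzero exponential left as an atom, [field] can cancel the conformal factor. *)
have EE : expR (-2 * coordinate x 0) = (expR (2 * coordinate x 0))^-1.
  by rewrite mulNr expRN.
have En : expR (2 * coordinate x 0) != 0 by rewrite gt_eqF ?expR_gt0.
by case: k i j => -[|[|[|[|//]]]] ? [[|[|[|[|//]]]] ?] [[|[|[|[|//]]]] ?];
  rewrite /tchris /tsub /= ?EE; field.
Qed.

(** The symbols of the rescaled metric are polynomial in the coordinates, so each component is a
    polynomial identity. *)
Lemma flat_curvature (l k i j : 'I_4) (x : 'rV[R]_4) :
  curvature (fun y : 'rV[R]_4 => expR (2 * - y 0 0) *: evmx 4 metric_term y)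
    l k i j x = 0.
Proof.
rewrite (curvature_ev flat_christoffel).
by case: l k i j => -[|[|[|[|//]]]] ? [[|[|[|[|//]]]] ?]
  [[|[|[|[|//]]]] ?] [[|[|[|[|//]]]] ?];
  rewrite /tcurv /tsub /=; ring.
Qed.

Lemma model_ricci (x : 'rV[R]_4) :
  ricci (evmx 4 metric_term) x = 4 *: delta_mx 0 0.
Proof.
rewrite (ricci_ev model_christoffel); apply/matrixP => i j; rewrite !mxE -!val_eqE.
by case: i j => -[|[|[|[|//]]]] ? [[|[|[|[|//]]]] ?];
  rewrite /tricci /tcurv /tsub /=; ring.
Qed.

Definition soliton_term (k : nat) : term R := if k is 1 then Cst (2 / 3) else T0.

Lemma model_lie_derivative (x : 'rV[R]_4) :
  lie_derivative (evrow 4 soliton_term) (evmx 4 metric_term) x = - 4 *: delta_mx 0 0.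
Proof.
rewrite lie_derivative_ev; apply/matrixP => i j; rewrite !mxE -!val_eqE.
by case: i j => -[|[|[|[|//]]]] ? [[|[|[|[|//]]]] ?]; rewrite /tlie /=; field.
Qed.

Lemma model_nabla_curvature :
  nabla_curvature (evmx 4 metric_term) 0 (inord 2) 0 (inord 2) 0 (0 : 'rV[R]_4) != 0.
Proof.
(* The curvature component is the constant 2, and two correction terms survive, each equal to -3 * 2
   with 3 the symbol with all indices 0. *)
rewrite (nabla_curvature_ev model_christoffel (curvature_ev model_christoffel)).
by rewrite !inordK //=.
Qed.

(** * Invariance, homogeneity, isotropy and the soliton equation *)

Definition model_metric : metric (affine_space R 4).
Proof.
apply: (@Defs.Metric R 4 (affine_space R 4) (fun _ => evmx 4 metric_term)).
- move=> c _ i j; rewrite (_ : (fun _ => _) = ev (metric_term i j)).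
    exact: ev_smooth.
  by apply/funext => x; rewrite mxE.
- move=> c _ x _; rewrite trmx_evmx; apply: eq_evmx.
  by case=> [|[|[|[|//]]]] [|[|[|[|//]]]].
- by move=> c _ x _; have [] := mulmx1_unit (metric_termK x).
- by move=> c d -> -> p _ _; rewrite jacobian_transition_id /= mul1mx trmx1 mulmx1.
Defined.

Definition soliton_field : vector_field (affine_space R 4).
Proof.
apply: (@VectorField R 4 (affine_space R 4) (fun _ => evrow 4 soliton_term)).
- by move=> c _; exact: evrow_smooth.
- by move=> c d -> -> p _ _; rewrite jacobian_transition_id mulmx1.
Defined.

(** Freezing the group parameters as constants leaves a term map of the point alone, whose Jacobian
    is symbolic. *)
Lemma gact_evrow (g : 'rV[R]_5) :
  gact g = evrow 4 (act_term (Cst (coordinate g 0)) (Cst (coordinate g 1))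
    (Cst (coordinate g 2)) (Cst (coordinate g 3)) (Cst (coordinate g 4))
    (Var 0) (Var 1) (Var 2) (Var 3)).
Proof.
by apply/funext => p; apply: coordinateP => -[|[|[|[|//]]]] _; rewrite /gact;
  do ! coordinates.
Qed.

Lemma model_invariant : invariant_metric model_action model_metric.
Proof.
move=> a c d -> -> p _ _.
rewrite /= -[id \o _ \o id]/(gact a) gact_evrow jacobian_evrow.
set s := act_term _ _ _ _ _ _ _ _ _.
have -> : evmx 4 metric_term (evrow 4 s p) =
    evmx 4 (fun i j => tsubst 4 s (metric_term i j)) p.
  by apply/matrixP => i j; rewrite !mxE ev_tsubst.
rewrite trmx_evmx !evmxM; apply: eq_evmx.
by case=> [|[|[|[|//]]]] [|[|[|[|//]]]] _ _; rewrite /s /=; field.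
Qed.

Lemma model_transitive : transitive_action model_action.
Proof.
have orbit0 (q : 'rV[R]_4) : exists a : 'rV[R]_5, gact a 0 = q.
  pose x := coordinate q 2; pose y := coordinate q 3.
  (* With a = 0, the origin goes to (t, b - (c^2 + d^2) / 2, c, d); solve for the parameters. The
     row of length 0 is a dummy argument for constant terms. *)
  exists (evrow 5 (nth T0 [:: T0; Cst (coordinate q 0);
     Cst (coordinate q 1 + (x ^+ 2 + y ^+ 2) / 2); Cst x; Cst y]) (0 : 'rV[R]_0)).
  apply: coordinateP => -[|[|[|[|//]]]] _; rewrite /gact /x /y; do ! coordinates;
    rewrite ?expR0; by field.
move=> p q; have [a ap] := orbit0 p; have [b bq] := orbit0 q.
(* Go from p back to the origin, then on to q. *)
by exists (gmul b (ginv a)); rewrite /= -ap gactM -(gactM (ginv a)) gmulVg gact1.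
Qed.

Lemma fixes_origin (g : 'rV[R]_5) :
  gact g 0 = 0 <-> forall i, (0 < i < 5)%N -> coordinate g i = 0.
Proof.
split=> [g0|g0].
  have E k : coordinate (gact g 0) k = 0 by rewrite g0 coordinate0.
  move: (E 0%N) (E 1%N) (E 2%N) (E 3%N); rewrite /gact; do ! coordinates; rewrite expR0.
  move=> E0 E1 E2 E3.
  have g1 : coordinate g 1 = 0 by rewrite -[RHS]E0; ring.
  have g3 : coordinate g 3 = 0 by rewrite -[RHS]E2; ring.
  have g4 : coordinate g 4 = 0 by rewrite -[RHS]E3; ring.
  (* The v-coordinate of the image is b - (c (c + a) + d^2) / 2, so b = 0 needs c = d = 0 first. *)
  have g2 : coordinate g 2 = 0 by rewrite -[RHS]E1 g3 g4; field.
  by case=> [|[|[|[|[|]]]]].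
have [g1 g2 g3 g4] := And4 (g0 1%N isT) (g0 2%N isT) (g0 3%N isT) (g0 4%N isT).
apply: coordinateP => -[|[|[|[|//]]]] _; rewrite /gact; do ! coordinates;
  rewrite ?(g1, g2, g3, g4) ?expR0; by field.
Qed.

Lemma model_effective : almost_effective model_action.
Proof.
exists setT; first exact: filterT.
move=> g _ gfix; have g0 := (fixes_origin g).1 (gfix 0).
(* Only a is left once the origin is fixed. At the point s = 1, v = x = y = 0 it shifts x by a e (e
   - 1), which forces a = 0. *)
have := gfix (evrow 4 (fun k => if k is 0 then T1 else T0) (0 : 'rV[R]_0)).
move=> /(congr1 (fun p => coordinate p 2)); rewrite /= /gact; do ! coordinates.
rewrite (g0 3%N) // => a0.
apply: coordinateP => -[|k] k5; last by rewrite coordinate0 g0.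
rewrite coordinate0; apply/eqP.
have : coordinate g 0 * (expR 1 * (expR 1 - 1)) = 0 by rewrite -[RHS]a0; ring.
move/eqP; rewrite !mulf_eq0 (gt_eqF (expR_gt0 1)) /= subr_eq0.
by rewrite (@gt_eqF _ _ (expR 1) 1) ?orbF ?expR_gt1 ?ltr01.
Qed.

Lemma model_isotropy : positive_dimensional (isotropy model_action (0 : 'rV[R]_4)).
Proof.
exists 1%N => //; split=> // p _; exists (id_chart R 5); split=> //.
  by move=> d ->; exact: id_chart_compatible.
rewrite /cimg /= !image_id !setTI; apply/seteqP; split=> g.
  by move=> /fixes_origin g0 i i1; rewrite -coordinateE g0 // i1 ltn_ord.
move=> g0; apply/fixes_origin => i /andP[i0 i5].
by rewrite -[i]/(nat_of_ord (Ordinal i5)) coordinateE g0.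
Qed.

Lemma model_soliton : ricci_soliton model_metric.
Proof.
exists soliton_field, 0 => c _ x _.
by rewrite /= model_lie_derivative model_ricci scale0r -scalerDl addNr scale0r.
Qed.

Lemma model_not_einstein : ~ einstein model_metric.
Proof.
case=> lam /(_ (id_chart R 4) erefl 0); rewrite /= /cimg image_id => /(_ I).
rewrite model_ricci => /matrixP E.
(* Entry (0, 1) gives [lam] = 0, while entry (0, 0) of the Ricci tensor is 4. *)
move: (E 0 (Ordinal (isT : 1 < 4)%N)) (E 0 0); rewrite !mxE /= !coordinate0; lra.
Qed.

Lemma model_conformally_flat : locally_conformally_flat model_metric.
Proof.
move=> p; exists setT, (fun p : 'rV[R]_4 => - p 0 0); split=> //.
- exact: openT.
- move=> c ->; rewrite (_ : _ \o _ = ev (-' Var 0)); first exact: ev_smooth.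
  by apply/funext => x /=; rewrite mulN1r -(coordinateE x 0).
- by move=> c -> x _ l k i j; exact: flat_curvature.
Qed.

Lemma model_not_locally_symmetric : ~ locally_symmetric model_metric.
Proof.
move=> /(_ (id_chart R 4) erefl 0); rewrite /= /cimg image_id => /(_ I) E.
by move: model_nabla_curvature; rewrite E eqxx.
Qed.

End PlaneWave.

Theorem mainTheorem4 (R : realType) :
  exists (N : nat) (G : lie_group R N) (M : manifold R 4)
         (A : lie_action G M) (o : M) (g : metric M),
    (transitive_action A /\ almost_effective A) /\
    positive_dimensional (isotropy A o) /\
    invariant_metric A g /\
    (ricci_soliton g /\ ~ einstein g) /\
    locally_conformally_flat g /\
    ~ locally_symmetric g.
Proof.
exists 5%N, (model_group R), (affine_space R 4), (model_action R), (0 : 'rV[R]_4),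
  (model_metric R).
split; first by split; [exact: model_transitive|exact: model_effective].
split; first exact: model_isotropy.
split; first exact: model_invariant.
split; first by split; [exact: model_soliton|exact: model_not_einstein].
by split; [exact: model_conformally_flat|exact: model_not_locally_symmetric].
Qed.
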